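(* Suppose $k$ is a positive integer and let $\alpha \in \mathbb{F}_2^k$. As $n \to \infty$ the following holds: \[ f_{\alpha}(n) = \begin{cases} 2^{\lfloor n/2 \rfloor} & \text{if } \operatorname{lv}(\alpha) = 0 \text{ and } \alpha = (0, \dots, 0),\\ 2^{\lfloor (n-1)/2 \rfloor} & \text{if } \operatorname{lv}(\alpha) = 0 \text{ and } \alpha = (1, \dots, 1),\\ \bigl(1 + o(1)\bigr) \cdot (t!)^{1/t} \cdot n^{1/t} & \text{if } \operatorname{lv}(\alpha) = t > 0 \text{ and } \operatorname{grd}(\alpha) = 1,\\ \bigl(1 + o(1)\bigr) \cdot (t!/2)^{1/t} \cdot n^{1/t} & \text{if } \operatorname{lv}(\alpha) = t > 0 \text{ and } \operatorname{grd}(\alpha) = 2. \end{cases} \]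
   Context: Write $[n] = \{1, \dots, n\}$ and let $2^{[n]}$ be its power set. For $\alpha = (\alpha_1, \dots, \alpha_k) \in \mathbb{F}_2^k$, a set family $\mathcal{F}$ is an $\alpha$-town if, for each $i = 1, \dots, k$, $|F_1 \cap \dots \cap F_i| \equiv \alpha_i \pmod 2$ holds for any distinct $F_1, \dots, F_i \in \mathcal{F}$. Let $f_\alpha(n)$ be the maximum of $|\mathcal{F}|$ over all $\alpha$-towns $\mathcal{F} \subseteq 2^{[n]}$. Canonical vectors: for integers $i \ge 1$, define infinite binary sequences $\gamma^{2i-1}, \gamma^{2i} \in \prod_{j=1}^\infty \mathbb{F}_2$ by, for every $j \ge 1$, \[ (\gamma^{2i-1})_j = \binom{-i}{j-1} \bmod 2 = \binom{i+j-2}{j-1} \bmod 2, \qquad (\gamma^{2i})_j = \binom{i-1}{j-1} \bmod 2, \] where $\binom{-a}{b} = \frac{(-a)(-a-1)\cdots(-a-b+1)}{b!}$ for $a \in \mathbb{Z}$, $b \in \mathbb{Z}_{\ge 0}$. For an infinite sequence $\gamma$, write $(\gamma)_{[k]} = (\gamma_1, \dots, \gamma_k) \in \mathbb{F}_2^k$. For every $k \ge 1$ the vectors $(\gamma^1)_{[k]}, \dots, (\gamma^k)_{[k]}$ form a basis of $\mathbb{F}_2^k$, so each $\alpha \in \mathbb{F}_2^k$ has a unique canonical decomposition $\alpha = c_1 (\gamma^1)_{[k]} + \dots + c_k (\gamma^k)_{[k]}$ with $c_1, \dots, c_k \in \mathbb{F}_2$. Level: $\operatorname{lv}(\gamma^i)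 = \lfloor i/2 \rfloor$, and $\operatorname{lv}(\alpha) = \max\{\operatorname{lv}(\gamma^i) : c_i = 1\}$, with the all-zero vector of any length having level $0$. Grade: if $\operatorname{lv}(\alpha) = t > 0$, then $\operatorname{grd}(\alpha) = 2$ if both $\gamma^{2t}$ and $\gamma^{2t+1}$ appear (with coefficient $1$) in the canonical decomposition of $\alpha$, and $\operatorname{grd}(\alpha) = 1$ if exactly one of them appears.
   Formalization: The formal theorem assumes k ≥ 2 rather than k ≥ 1, because for k = 1 both α = (0) and α = (1) give f_α(n) = 2^{n-1}, which contradicts the stated formulas for n ≥ 3. *)

(* Defs.v *)
From HB Require Import structures.
From mathcomp Require Import all_boot all_order all_algebra.
From mathcomp Require Import all_classical all_reals all_analysis.
From mathcomp Require Import zify.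

Set Implicit Arguments.
Unset Strict Implicit.
Unset Printing Implicit Defensive.

Import Order.TTheory GRing.Theory Num.Theory.
Import numFieldNormedType.Exports.

Local Open Scope ring_scope.

(* The coordinate [alpha_i] of the mathematics, 1 <= i <= k, is [alpha 0 i']
   with [i = i'.+1], so an i-tuple has type [i'.+1.-tuple]. *)
Definition is_town (k : nat) (alpha : 'rV['F_2]_k) (n : nat)
    (F : {set {set 'I_n}}) : bool :=
  [forall i : 'I_k, forall G : i.+1.-tuple {set 'I_n},
     uniq G && all (mem F) G ==>
       (#|(\bigcap_(A <- G) A)%SET|%:R == alpha 0 i)].

Definition town_max (k : nat) (alpha : 'rV['F_2]_k) (n : nat) : nat :=
  \max_(F : {set {set 'I_n}} | is_town alpha F) #|F|.

(* [gamma i j] is the j-th entry of the i-th canonical sequence; both indices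
   start at 1.  For [i = 2a - 1] we have [uphalf i = a], and the entry
   'C(-a, j - 1) is, up to sign, 'C(a + j - 2, j - 1); for [i = 2a] we have
   [i./2 = a]. *)
Definition gamma (i j : nat) : 'F_2 :=
  if odd i then 'C(uphalf i + j - 2, j.-1)%:R else 'C(i./2.-1, j.-1)%:R.

Definition gamma_row (k i : nat) : 'rV['F_2]_k := \row_(j < k) gamma i j.+1.

Definition gamma_tuple (k : nat) : k.-tuple 'rV['F_2]_k :=
  [tuple gamma_row k i.+1 | i < k].

(* The canonical sequences have generating series (1 + x)^-a and (1 + x)^(a - 1);
   multiplied by (1 + x)^(uphalf k) and truncated at degree k, the first k of
   them become 1, 1 + x, ..., (1 + x)^(k - 1). *)
Section GammaBasis.

Local Notation P := {poly 'F_2}.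

Local Definition negbin (k a : nat) : P := \poly_(j < k) 'C(a + j - 1, j)%:R.

Local Lemma negbinP (k a : nat) : (0 < k)%N ->
  exists q : P, (1 + 'X) ^+ a * negbin k a = 1 + q * 'X^k.
Proof.
move=> k_gt0; elim: a => [|a [q IH]].
  exists 0; rewrite mul0r addr0 mul1r; apply/polyP => j.
  rewrite coef_poly coef1 add0n; case: j => [|j]; first by rewrite k_gt0.
  by rewrite subn1 bin_small // if_same.
suff [c Ec] : exists c : 'F_2,
    (1 + 'X) * negbin k a.+1 = negbin k a + c%:P * 'X^k.
  exists (q + (1 + 'X) ^+ a * c%:P).
  by rewrite exprSr -mulrA Ec mulrDr IH mulrDl !mulrA addrA.
exists 'C(a.+1 + k.-1 - 1, k.-1)%:R; apply/polyP => j.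
rewrite mulrDl mul1r !coefD coefXM coefCM coefXn !coef_poly.
case: j => [|j]; first by rewrite k_gt0 (ltn_eqF k_gt0) !bin0 mulr0.
case: (ltngtP j.+1 k) => [lt_jk|lt_kj|<-] /=.
- rewrite mulr0 addr0.
  rewrite !addSn !addnS !subn1 /= binS natrD -addrA -mulr2n.
  have -> (x : 'F_2) : x *+ 2 = 0 by rewrite -mulr_natr (pchar_Fp_0 _) ?mulr0.
  by rewrite addr0.
- by rewrite mulr0 !addr0.
- by rewrite add0r mulr1 add0r.
Qed.

Local Lemma coef_exp1X (n j : nat) : ((1 + 'X : P) ^+ n)`_j = 'C(n, j)%:R.
Proof.
elim: n j => [|n IH] j; first by rewrite expr0 coef1 bin0n.
rewrite exprS mulrDl mul1r coefD coefXM !IH; case: j => [|j] /=.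
  by rewrite addr0 !bin0.
by rewrite binS natrD.
Qed.

Local Definition expo (k i : nat) : nat :=
  if odd i then (uphalf k + i./2)%N else (uphalf k - i./2.+1)%N.

Local Lemma expo_lt (k i : nat) : (i < k)%N -> (expo k i < k)%N.
Proof. by rewrite /expo => ik; case: ifP => oi; lia. Qed.

Local Lemma expo_inj (k i j : nat) :
  (i < k)%N -> (j < k)%N -> expo k i = expo k j -> i = j.
Proof. by rewrite /expo => ik jk; case: ifP; case: ifP => ? ? ?; lia. Qed.

Local Lemma gamma_expo (k i : nat) : (i < k)%N -> exists q : P,
  (1 + 'X) ^+ (uphalf k) * rVpoly (gamma_row k i.+1)
  = (1 + 'X) ^+ expo k i + q * 'X^k.
Proof.
move=> ik; have k_gt0 : (0 < k)%N by case: k ik.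
rewrite /expo; case: ifP => oi.
  exists 0; rewrite mul0r addr0 exprD; congr (_ * _); apply/polyP => j.
  rewrite coef_exp1X coef_rVpoly; case: insubP => [u _ <-|]; last first.
    by rewrite -leqNgt => kj; rewrite bin_small //; lia.
  by rewrite mxE /gamma /= oi uphalfE /= (_ : i.+1./2.-1 = i./2) //; lia.
have [q Eq] := negbinP i./2.+1 k_gt0.
exists ((1 + 'X) ^+ (uphalf k - i./2.+1) * q).
rewrite (_ : rVpoly _ = negbin k i./2.+1); last first.
  apply/polyP => j; rewrite coef_rVpoly coef_poly.
  case: insubP => [u -> <-|/negbTE -> //].
  rewrite mxE /gamma /= oi /=; congr (('C(_, _))%:R); lia.
rewrite -{1}(@subnK i./2.+1 (uphalf k)); last by lia.
by rewrite exprD -mulrA Eq mulrDr mulr1 mulrA.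
Qed.

Local Lemma gamma_tupleE (k : nat) (j : 'I_k) :
  (gamma_tuple k)`_j = gamma_row k j.+1.
Proof. by rewrite -tnth_nth tnth_mktuple. Qed.

Lemma gamma_free (k : nat) : free (gamma_tuple k).
Proof.
apply/freeP => c c0 i.
pose S : P := \sum_(j < k) c j *: (1 + 'X) ^+ expo k j.
have [q Eq] : exists q : P, S = q * 'X^k.
  have [r Er] := fin_all_exists (fun j : 'I_k => gamma_expo (ltn_ord j)).
  exists (- \sum_(j < k) c j *: r j).
  apply/eqP; rewrite mulNr -addr_eq0 mulr_suml -big_split /=.
  rewrite (eq_bigr (fun j : 'I_k =>
      (1 + 'X) ^+ uphalf k * rVpoly (c j *: (gamma_tuple k)`_j))); last first.
    by move=> j _; rewrite gamma_tupleE -scalerAl -scalerDr -Er linearZ /= scalerAr.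
  by rewrite -mulr_sumr -linear_sum c0 linear0 mulr0.
have sz1X n : size ((1 + 'X : P) ^+ n) = n.+1.
  by rewrite addrC -[1]opprK -polyC1 -polyCN size_exp_XsubC.
have S0 : S = 0.
  have szS : (size S <= k)%N.
    apply: (leq_trans (size_sum _ _ _)); apply/bigmax_leqP => j _.
    by rewrite (leq_trans (size_scale_leq _ _)) // sz1X expo_lt.
  apply/eqP; apply: contraTT szS => Sn0; rewrite -ltnNge Eq.
  have qn0 : q != 0 by apply: contra_neq Sn0 => q0; rewrite Eq q0 mul0r.
  by rewrite size_mulXn // -[X in (X < _)%N]addn0 ltn_add2l size_poly_gt0.
have XE : (1 + 'X : P) \Po ('X - 1%:P) = 'X.
  by rewrite -polyC1 comp_polyD comp_polyX comp_polyC addrC subrK.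
have : S \Po ('X - 1%:P) = 0 by rewrite S0 comp_poly0.
rewrite /S raddf_sum /= => /(congr1 (fun p : P => p`_(expo k i))).
rewrite coef0 coef_sum (bigD1 i) //= big1 => [|j ji].
  by rewrite comp_polyZ rmorphXn /= XE coefZ coefXn eqxx mulr1 addr0.
rewrite comp_polyZ rmorphXn /= XE.
rewrite coefZ coefXn; case: eqP => [E|]; last by rewrite mulr0.
by case/eqP: ji; apply: val_inj; apply: (expo_inj (ltn_ord j) (ltn_ord i)).
Qed.

Lemma gamma_basis (k : nat) : basis_of fullv (gamma_tuple k).
Proof.
rewrite basisEfree gamma_free subvf size_tuple dimvf.
by rewrite [dim _]mul1n leqnn.
Qed.

End GammaBasis.

Definition canon_coef (k : nat) (alpha : 'rV['F_2]_k) (i : 'I_k) : 'F_2 :=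
  coord (gamma_tuple k) i alpha.

Lemma canon_decomp (k : nat) (alpha : 'rV['F_2]_k) :
  alpha = \sum_(i < k) canon_coef alpha i *: gamma_row k i.+1.
Proof.
rewrite {1}(coord_basis (gamma_basis k) (memvf alpha)).
by apply: eq_bigr => i _; rewrite gamma_tupleE.
Qed.

Lemma canon_decomp_unique (k : nat) (c : 'I_k -> 'F_2) (i : 'I_k) :
  canon_coef (\sum_(j < k) c j *: gamma_row k j.+1) i = c i.
Proof.
rewrite -[RHS](coord_sum_free c i (gamma_free k)); congr (coord _ _ _).
by apply: eq_bigr => j _; rewrite gamma_tupleE.
Qed.

(* [gamma^i] (index from 1) occurs in the canonical decomposition of [alpha];
   it never does when i > k. *)
Definition appears (k : nat) (alpha : 'rV['F_2]_k) (i : nat) : bool :=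
  [exists j : 'I_k, (j.+1 == i) && (canon_coef alpha j == 1)].

Definition gamma_level (i : nat) : nat := i./2.

Definition level (k : nat) (alpha : 'rV['F_2]_k) : nat :=
  \max_(1 <= i < k.+1 | appears alpha i) gamma_level i.

(* Meaningful only when [level alpha > 0]; at least one of the two terms is then
   1, the level being attained. *)
Definition grade (k : nat) (alpha : 'rV['F_2]_k) : nat :=
  appears alpha (level alpha).*2 + appears alpha (level alpha).*2.+1.

(* u_n = (1 + o(1)) v_n as n tends to infinity. *)
Definition eq_1o1 (R : realType) (u v : nat -> R) : Prop :=
  exists2 e : nat -> R,
    (e n @[n --> \oo] --> (0 : R))%classic
    & (\forall n \near \oo, u n = (1 + e n) * v n)%classic.

(* Main.v *)
Require Import Defs.
From HB Require Import structures.
From mathcomp Require Import all_boot all_order all_algebra.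
From mathcomp Require Import all_classical all_reals all_analysis.
From mathcomp Require Import zify lra.

(** Upper bound: for t-subsets S of a town minus one member, the Gram matrix of
    the intersections over S depends only on |S n S'|, hence over F_2 it is the
    identity (this is where the level enters) plus low-rank terms, so at most
    about n such S exist.  In grade 2 this applies separately to the traces on
    the removed member and on its complement, and the two bounds add up.  Lower
    bound: members are indexed by [m], with m divisible by a large power of 2;
    points are s-subsets of [m], for suitable s <= t, lying in the members that
    they contain or in those that they avoid. *)

Set Implicit Arguments.
Unset Strict Implicit.
Unset Printing Implicit Defensive.

Import Order.TTheory GRing.Theory Num.Theory.
Import numFieldNormedType.Exports.

Local Open Scope ring_scope.

(** * Finite differences over ['F_2] and their values on the canonical sequences *)

Lemma addrr_F2 (x : 'F_2) : x + x = 0.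
Proof. by rewrite addrr_pchar2 ?pchar_Fp. Qed.

Lemma F2P (x : 'F_2) : x = (x == 1)%:R.
Proof.
by case: x => [[|[|m]] lt_m] //; apply/val_inj.
Qed.

Definition fdiff (a : nat -> 'F_2) (j : nat) : 'F_2 := a j + a j.+1.

Lemma iter_fdiff_rev (a : nat -> 'F_2) (N r x : nat) : (r + x <= N)%N ->
  iter r fdiff (fun y => a (N - y)%N) x = iter r fdiff a (N - x - r)%N.
Proof.
elim: r x => [|r IH] x le_N; first by rewrite subn0.
rewrite !iterS /fdiff !IH; try lia.
rewrite addrC; congr (iter r fdiff a _ + iter r fdiff a _); lia.
Qed.

(** Newton's forward difference formula. The limit [m] is left free so that one sum of fixed length
    serves all intersection sizes [x <= t]. *)
Lemma newton_F2 (b : nat -> 'F_2) (m x : nat) : (x <= m)%N ->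
  b x = \sum_(r < m.+1) 'C(x, r)%:R * iter r fdiff b 0%N.
Proof.
elim: x b m => [|x IH] b m le_xm.
  rewrite big_ord_recl /= bin0 mul1r big1 ?addr0 // => r _.
  by rewrite bin0n mul0r.
case: m le_xm => // m le_xm.
have -> : b x.+1 = b x + fdiff b x by rewrite /fdiff addrA addrr_F2 add0r.
rewrite (IH b m.+1) ?(ltnW le_xm) //. rewrite (IH (fdiff b) m) //.
rewrite big_ord_recl [RHS]big_ord_recl /= !bin0 -addrA; congr (_ + _).
rewrite -big_split; apply: eq_bigr => r _ /=.
by rewrite -iterSr iterS /bump add1n binS natrD mulrDl.
Qed.

Lemma iter_fdiff_sum (k t : nat) (c : 'I_k -> 'F_2) (h : 'I_k -> nat -> 'F_2) j :
  iter t fdiff (fun x => \sum_(i < k) c i * h i x) j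
  = \sum_(i < k) c i * iter t fdiff (h i) j.
Proof.
elim: t j => [//|t IH] j; rewrite iterS /fdiff !IH -big_split.
by apply: eq_bigr => i _ /=; rewrite -mulrDr.
Qed.

Lemma iter_fdiff_shift (a : nat -> 'F_2) (t j : nat) :
  iter t fdiff (fun x => a x.+1) j = iter t fdiff a j.+1.
Proof. by elim: t j => [//|t IH] j; rewrite !iterS /fdiff !IH. Qed.

Lemma iter_fdiff_diff (a : nat -> 'F_2) (t j : nat) :
  iter t fdiff (fdiff a) j = iter t fdiff a j + iter t fdiff a j.+1.
Proof. by rewrite -iterSr. Qed.

Lemma iter_fdiff_gamma_even (s r j : nat) :
  iter r fdiff (gamma s.+1.*2) j.+1 = 'C(s + r, j + r)%:R.
Proof.
elim: r j => [|r IH] j; first by rewrite /gamma odd_double doubleK !addn0.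
by rewrite iterS /fdiff !IH !addnS binS natrD addrC addSn.
Qed.

(** By Pascal's rule modulo 2, each difference lowers the lower index by one, until the constant 1
    is reached and then killed. *)
Lemma iter_fdiff_gamma_odd (s r j : nat) :
  iter r fdiff (gamma s.*2.+1) j.+1 = if (r <= s)%N then 'C(s + j, s - r)%:R else 0.
Proof.
elim: r j => [|r IH] j.
  rewrite /gamma /= odd_double /= doubleK subn0.
  by congr ((_)%:R); rewrite -bin_sub ?leq_addl; [congr ('C(_, _))|]; lia.
rewrite iterS /fdiff !IH; case: (ltngtP r s) => [lt_rs|//|->].
  - rewrite -(subnSK lt_rs) addnS binS natrD addrA addrr_F2.
    by rewrite add0r.
  - by rewrite addr0.
  - by rewrite subnn !bin0 addrr_F2.
Qed.

(** The [t]-th difference isolates the top level: lower levels die from the argument [t] on, while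
    the two sequences of level [t] agree at [t] and differ beyond it. This contrast is what
    separates grade 2 from grade 1. *)
Lemma iter_fdiff_gamma (t i j : nat) :
  (0 < t)%N -> (0 < i <= t.*2.+1)%N -> (t <= j)%N ->
  iter t fdiff (gamma i) j = ((i == t.*2.+1) || (i == t.*2) && (j == t))%:R.
Proof.
move=> t_gt0 /andP[i_gt0 le_i] le_tj; case: j le_tj => [|j] le_tj; first by lia.
case: (boolP (odd i)) => odd_i.
  have -> : i = i./2.*2.+1 by lia.
  rewrite iter_fdiff_gamma_odd; case: (ltngtP t i./2) => ti; first by lia.
    by rewrite [X in (nat_of_bool X)%:R](_ : _ = false) //; lia.
  by rewrite ti subnn bin0 [X in (nat_of_bool X)%:R](_ : _ = true) //; lia.
have -> : i = (i./2.-1).+1.*2 by lia.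
rewrite iter_fdiff_gamma_even.
case: (ltngtP (i./2.-1 + t)%N (j + t)%N) => ji; last 1 first.
- by rewrite ji binn [X in (nat_of_bool X)%:R](_ : _ = true) //; lia.
- by rewrite bin_small // [X in (nat_of_bool X)%:R](_ : _ = false) //; lia.
- by lia.
Qed.

(** * Incidence matrices and the rank bound *)

Section IncidenceMatrix.

Variables (U V : finType).

Definition incidence_mx (X : {set U}) (Y : {set V}) (e : U -> V -> bool)
    : 'M['F_2]_(#|X|, #|Y|) :=
  \matrix_(i, j) (e (enum_val i) (enum_val j))%:R.

Lemma incidence_mul (X : {set U}) (Y : {set V}) (e : U -> V -> bool) i j :
  (incidence_mx X Y e *m (incidence_mx X Y e)^T) i j
  = #|[set y in Y | e (enum_val i) y && e (enum_val j) y]|%:R.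
Proof.
rewrite mxE; pose p y := e (enum_val i) y && e (enum_val j) y.
transitivity (\sum_(y in Y | p y) 1%:R : 'F_2).
  rewrite big_mkcondr [RHS]big_enum_val /=.
  apply: eq_bigr => y _; rewrite !mxE -natrM /p.
  by case: (e _ _); case: (e _ _).
rewrite -natr_sum sum1_card; congr (_%:R); apply: eq_card => y.
by rewrite !inE.
Qed.

Lemma rank_incidence (X : {set U}) (Y : {set V}) (e : U -> V -> bool) (b : 'F_2) :
  (\rank (b *: (incidence_mx X Y e *m (incidence_mx X Y e)^T)) <= #|Y|)%N.
Proof.
apply: leq_trans (mxrank_scale _ _) _.
exact: leq_trans (mxrankM_maxl _ _) (rank_leq_col _).
Qed.

End IncidenceMatrix.

Definition ksubsets (I : finType) (G : {set I}) (t : nat) : {set {set I}} :=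
  [set S : {set I} | (S \subset G) & (#|S| == t)].

Lemma card_ksubsets (I : finType) (G : {set I}) (t : nat) :
  #|ksubsets G t| = 'C(#|G|, t).
Proof. exact: cards_draws. Qed.

Lemma ksubsetsP (I : finType) (G : {set I}) (t : nat) (S : {set I}) :
  reflect (S \subset G /\ #|S| = t) (S \in ksubsets G t).
Proof. by rewrite inE; apply: (iffP andP) => -[? /eqP]. Qed.

Lemma card_common_ksubsets (I : finType) (G S T : {set I}) (r : nat) :
  S \subset G ->
  #|[set K in ksubsets G r | (K \subset S) && (K \subset T)]|
  = 'C(#|S :&: T|, r).
Proof.
move=> SG; rewrite -card_ksubsets; apply: eq_card => K.
rewrite !inE finset.subsetI; case: (boolP (K \subset S)) => [KS|_] /=.
  by rewrite (fintype.subset_trans KS SG) andbC.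
by rewrite andbF.
Qed.

(* The Gram matrix over F_2 of the intersections over t-subsets S depends only
   on |S n S'|; by Newton's formula it is the identity plus a combination of
   r-subset incidence products with r < t. *)
Lemma town_rank_bound (I T : finType) (A : I -> {set T}) (P : {set T})
    (G : {set I}) (a : nat -> 'F_2) (t : nat) :
  (0 < t)%N -> iter t fdiff a t = 1 ->
  (forall S : {set I}, S \subset G -> (t <= #|S| <= t.*2)%N ->
     #|P :&: (\bigcap_(i in S) A i)%SET|%:R = a #|S|) ->
  ('C(#|G|, t) <= #|P| + \sum_(r < t) 'C(#|G|, r))%N.
Proof.
move=> t_gt0 at1 Pa.
pose X := ksubsets G t.
pose V := incidence_mx X P (fun S p => p \in (\bigcap_(i in S) A i)%SET).
pose W r := incidence_mx X (ksubsets G r) (fun S K => K \subset S).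
(* Two [t]-sets meeting in [x] points have a union of size [2t - x], so [b] expresses the Gram
   entries through [x]. Reversal turns its [t]-th difference at 0 into that of [a] at [t]. *)
pose b x := a (t.*2 - x)%N.
pose c r := iter r fdiff b 0%N.
have ct : c t = 1.
  rewrite /c /b iter_fdiff_rev; last by lia.
  by rewrite -[RHS]at1; congr (iter t fdiff a _); lia.
have VE : 1%:M = V *m V^T + \sum_(r < t) c r *: (W r *m (W r)^T).
  apply/matrixP => i j; rewrite [in RHS]mxE summxE incidence_mul.
  have /ksubsetsP[SG cS] := enum_valP i; have /ksubsetsP[TG cT] := enum_valP j.
  set S := enum_val i in SG cS *; set S' := enum_val j in TG cT *.
  have le_x : (#|S :&: S'| <= t)%N by rewrite -cS subset_leq_card // finset.subsetIl.
  have cU : #|S :|: S'| = (t.*2 - #|S :&: S'|)%N by rewrite cardsU cS cT addnn.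
  have -> : #|[set y in P | (y \in (\bigcap_(i0 in S) A i0)%SET)
              && (y \in (\bigcap_(i0 in S') A i0)%SET)]|%:R = b #|S :&: S'| :> 'F_2.
    rewrite /b -cU -Pa ?finset.subUset ?SG //; last by rewrite cU; lia.
    congr (_%:R); apply: eq_card => y; rewrite finset.bigcap_setU !inE.
    by [].
  (* The last Newton term has coefficient 1 and value ['C(x, t)], nonzero only when the two [t]-sets
     coincide: it is the identity matrix. The terms [r < t] cancel against the sum already
     present. *)
  rewrite (newton_F2 b le_x) big_ord_recr /= -/(c t) ct mulr1 addrAC.
  rewrite (eq_bigr (fun r : 'I_t => c r * (W r *m (W r)^T) i j)); last first.
    by move=> r _; rewrite /W incidence_mul card_common_ksubsets // mulrC.
  rewrite [X in _ + X + _](eq_bigr (fun r : 'I_t => c r * (W r *m (W r)^T) i j)); last first.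
    by move=> r _; rewrite mxE.
  rewrite addrr_F2 add0r mxE.
  case: (eqVneq i j) => [eq_ij|ne_ij].
    by rewrite /S' -eq_ij finset.setIid cS binn.
  rewrite bin_small // ltn_neqAle le_x andbT; apply: contra ne_ij => /eqP cI.
  have ES : S :&: S' = S by apply/eqP; rewrite eqEcard finset.subsetIl cS cI leqnn.
  have ES' : S :&: S' = S' by apply/eqP; rewrite eqEcard finset.subsetIr cT cI leqnn.
  by apply/eqP/enum_val_inj; rewrite -/S -/S' -ES ES'.
rewrite -card_ksubsets -/X -(mxrank1 'F_2 #|X|) VE.
apply: leq_trans (mxrank_add _ _) _; apply: leq_add.
  exact: leq_trans (mxrankM_maxl _ _) (rank_leq_col _).
elim/big_ind2: _ => [|x M y N le_M le_N|r _]; first by rewrite mxrank0.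
  exact: leq_trans (mxrank_add _ _) (leq_add le_M le_N).
by rewrite -card_ksubsets rank_incidence.
Qed.

(** * The canonical decomposition and the upper bound at positive level *)

(** Prolongs [alpha] past its length, so that differences can be taken without bounding the argument
    by [k]. *)
Definition canon_seq (k : nat) (alpha : 'rV['F_2]_k) (j : nat) : 'F_2 :=
  \sum_(i < k) (appears alpha i.+1)%:R * gamma i.+1 j.

Lemma appears_ord (k : nat) (alpha : 'rV['F_2]_k) (i : 'I_k) :
  appears alpha i.+1 = (canon_coef alpha i == 1).
Proof.
apply/existsP/idP => [[j /andP[/eqP/eq_add_S/val_inj <-]] //|ci1].
by exists i; rewrite eqxx.
Qed.

Lemma appears_le (k : nat) (alpha : 'rV['F_2]_k) (i : nat) :
  appears alpha i -> (0 < i <= k)%N.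
Proof. by case/existsP => j /andP[/eqP <- _] /=. Qed.

Lemma canon_seqE (k : nat) (alpha : 'rV['F_2]_k) (j : 'I_k) :
  canon_seq alpha j.+1 = alpha 0 j.
Proof.
rewrite [in RHS](canon_decomp alpha) summxE; apply: eq_bigr => i _.
by rewrite appears_ord [in RHS]mxE -F2P mxE.
Qed.

Lemma appears_level (k : nat) (alpha : 'rV['F_2]_k) (i : nat) :
  appears alpha i -> (i <= (level alpha).*2.+1)%N.
Proof.
move=> ai; have := appears_le ai; move=> /andP[i_gt0 le_ik].
suff: (i./2 <= level alpha)%N by lia.
rewrite /level /index_iota subn1 /=.
rewrite (@leq_bigmax_seq _ _ _ gamma_level) //.
by rewrite mem_iota; lia.
Qed.

(** Writes each summand of the grade as a sum over the index range of the decomposition, for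
    comparison term by term. *)
Lemma sum_appears (k : nat) (alpha : 'rV['F_2]_k) (p : nat) :
  (\sum_(i < k) (appears alpha i.+1 && (i.+1 == p)) = appears alpha p)%N.
Proof.
case: (boolP (appears alpha p)) => ap; last first.
  by rewrite big1 // => i _; case: eqP => [->|]; rewrite ?andbF // (negbTE ap).
have /andP[p_gt0 le_pk] := appears_le ap.
have lt_pk : (p.-1 < k)%N by rewrite prednK.
rewrite (bigD1 (Ordinal lt_pk)) //= prednK // ap eqxx big1 // => i ne_i.
by case: eqP => [E|]; [case/eqP: ne_i; apply: val_inj; rewrite /= -E|rewrite andbF].
Qed.

Lemma iter_fdiff_canon_seq (k : nat) (alpha : 'rV['F_2]_k) (j : nat) :
  let t := level alpha in (0 < t)%N -> (t <= j)%N ->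
  iter t fdiff (canon_seq alpha) j
  = (appears alpha t.*2.+1 + appears alpha t.*2 * (j == t))%:R.
Proof.
move=> t t_gt0 le_tj; rewrite iter_fdiff_sum.
rewrite -(sum_appears alpha t.*2.+1) -(sum_appears alpha t.*2).
rewrite big_distrl -big_split natr_sum /=; apply: eq_bigr => i _.
case: (boolP (appears alpha i.+1)) => ai; last by rewrite mul0r.
rewrite mul1r iter_fdiff_gamma ?appears_level // natrD natrM.
case: eqP => [->|_] /=; first by rewrite [_ == t.*2]gtn_eqF ?mul0r ?addr0.
by rewrite add0r; case: eqP => _ /=; rewrite ?mul1r ?mul0r.
Qed.

Lemma is_townP (k : nat) (alpha : 'rV['F_2]_k) (n : nat) (F : {set {set 'I_n}}) :
  reflect (forall S : {set {set 'I_n}}, S \subset F -> (0 < #|S| <= k)%N ->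
             #|(\bigcap_(A in S) A)%SET|%:R = canon_seq alpha #|S|)
          (is_town alpha F).
Proof.
apply: (iffP idP) => [Ftown S SF|Fcap].
  move=> /andP[S_gt0 le_Sk]; have lt_Sk : (#|S|.-1 < k)%N by rewrite prednK.
  have sz : size (enum S) == (Ordinal lt_Sk).+1 by rewrite -cardE /= prednK.
  have /forallP/(_ (Ordinal lt_Sk))/forallP/(_ (Tuple sz))/implyP := Ftown.
  rewrite /= enum_uniq big_enum -canon_seqE /= prednK // => H; apply/eqP/H.
  by apply/allP => A; rewrite mem_enum; apply: (fintype.subsetP SF).
apply/forallP => i; apply/forallP => G; apply/implyP => /andP[uG GF].
pose S := [set A in tval G]; have cS : #|S| = i.+1.
  by rewrite cardsE (card_uniqP uG) size_tuple.
have SF : S \subset F.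
  by apply/fintype.subsetP => A; rewrite inE => /(allP GF).
have := Fcap S SF; rewrite cS ltn_ord => /(_ isT).
rewrite canon_seqE => <-; apply/eqP; congr ((#|pred_of_set _|)%:R).
by rewrite big_uniq //=; apply: eq_bigl => A; rewrite inE.
Qed.

(** In grade 1 the [t]-th difference at [t] is 1, and the rank bound applies on the whole ground
    set. In grade 2 the two top sequences cancel at [t], but the difference at [t + 1] is still 1;
    intersecting with the removed member [z] shifts the argument by one and gives access to it. *)
Lemma town_card_bound (k : nat) (alpha : 'rV['F_2]_k) (n : nat)
    (F : {set {set 'I_n}}) :
  let t := level alpha in let g := grade alpha in
  is_town alpha F -> (0 < t)%N -> (0 < #|F|)%N -> (0 < g)%N ->
  (g * 'C(#|F|.-1, t) <= n + g * \sum_(r < t) 'C(#|F|.-1, r))%N.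
Proof.
move=> t g Ft t_gt0 F_gt0 g_gt0.
have [z zF] : exists z, z \in F by apply/finset.set0Pn; rewrite -card_gt0.
have cG : #|F :\ z| = #|F|.-1 by rewrite (cardsD1 z F) zF.
have le_k i : appears alpha i -> (i <= k)%N by move/appears_le/andP => [].
have := iter_fdiff_canon_seq (alpha := alpha) t_gt0 (leqnn _).
have := iter_fdiff_canon_seq (alpha := alpha) t_gt0 (leqnSn _).
rewrite -/t eqxx muln1 [t.+1 == t]gtn_eqF // muln0 addn0.
move: (le_k t.*2) (le_k t.*2.+1); move: g_gt0; rewrite /g /grade -/t.
have town (S : {set {set 'I_n}}) : S \subset F :\ z -> (#|S| < k)%N ->
    #|z :&: (\bigcap_(A in S) A)%SET|%:R = canon_seq alpha #|S|.+1.
  move=> SG lt_Sk; have zS : z \notin S.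
    by apply/negP => /(fintype.subsetP SG); rewrite !inE eqxx.
  have cS : #|z |: S| = #|S|.+1 by rewrite cardsU1 zS.
  rewrite -cS -(is_townP _ _ Ft); last by rewrite cS.
    by rewrite finset.big_setU1.
  by rewrite finset.subUset finset.sub1set zF (fintype.subset_trans SG) ?finset.subsetDl.
case: (boolP (appears alpha t.*2)) => aA; case: (boolP (appears alpha t.*2.+1)) => aB //= _ kA kB DS D.
(* Adding [z] to a family of at most [2t] members needs [2t + 1 <= k], which holds because
   [gamma^(2t+1)] appears. *)
- have le_tk := kB isT.
  have Dz : iter t fdiff (fun x => canon_seq alpha x.+1) t = 1.
    by rewrite iter_fdiff_shift DS.
  (* Outside [z] the sizes follow the sum of the sequence and its shift, so the difference is 0 +
     1. *)
  have Dc : iter t fdiff (fdiff (canon_seq alpha)) t = 1.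
    by rewrite iter_fdiff_diff D DS natrD addrr_F2 add0r.
  have := @town_rank_bound _ _ id z (F :\ z) _ t t_gt0 Dz.
  have := @town_rank_bound _ _ id (~: z) (F :\ z) _ t t_gt0 Dc.
  rewrite cG => Hc Hz.
  rewrite !mulSn !mul0n !addn0.
  apply: leq_trans (leq_add (Hz _) (Hc _)) _.
  + by move=> S SG /andP[_ le_S]; apply: town (leq_ltn_trans le_S le_tk).
  + move=> S SG /andP[le_tS le_S]; rewrite /fdiff -town //; last first.
      exact: leq_ltn_trans le_S le_tk.
    rewrite -(is_townP _ _ Ft); last 2 first.
    * by rewrite (fintype.subset_trans SG) ?finset.subsetDl.
    * by rewrite (leq_trans t_gt0 le_tS) (leq_trans le_S (ltnW le_tk)).
    set C := (\bigcap_(A in S) A)%SET.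
    rewrite -(cardsID z C) natrD finset.setDE (finset.setIC z) (finset.setIC (~: z)).
    by rewrite addrAC addrr_F2 add0r.
  by rewrite addnACA cardsC card_ord.
all: rewrite ?addn0 ?add0n !mul1n -cG -[X in (_ <= X + _)%N](card_ord n) -cardsT.
all: apply: (@town_rank_bound _ _ id [set: 'I_n] (F :\ z) _ t t_gt0 D).
all: move=> S SG /andP[le_tS le_S]; rewrite finset.setTI; apply: (is_townP _ _ Ft).
all: rewrite ?(fintype.subset_trans SG) ?finset.subsetDl //.
all: rewrite (leq_trans t_gt0 le_tS) (leq_trans le_S) //.
  exact: kA.
exact: ltnW (kB isT).
Qed.

(** * Towns built on arbitrary finite ground sets *)

(** Numbering the points of [Q] by ['I_n] preserves the intersection sizes: for nonempty [J] the
    intersection stays inside [Q], where the numbering is injective. *)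
Lemma leq_town_max (k : nat) (alpha : 'rV['F_2]_k) (n : nat) (U X : finType)
    (Q : {set U}) (f : X -> {set U}) :
  (0 < n)%N -> injective f -> (forall x, f x \subset Q) -> (#|Q| <= n)%N ->
  (forall J : {set X}, (0 < #|J| <= k)%N ->
     #|(\bigcap_(x in J) f x)%SET|%:R = canon_seq alpha #|J|) ->
  (#|X| <= town_max alpha n)%N.
Proof.
move=> n_gt0 inj_f fQ le_Qn fcap.
(* A point of [Q] has index below [#|Q| <= n], so the default of [insubd] is never taken on [Q]. *)
pose h (u : U) : 'I_n := insubd (Ordinal n_gt0) (index u (enum Q)).
have inj_h : {in Q &, injective h}.
  move=> u v uQ vQ /(congr1 val); rewrite !val_insubd.
  have lt_n w : w \in Q -> (index w (enum Q) < n)%N.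
    by move=> wQ; rewrite (leq_trans _ le_Qn) // cardE index_mem mem_enum.
  rewrite !lt_n // => E; rewrite -(nth_index u (s := enum Q) (x := u)) ?mem_enum //.
  by rewrite E nth_index // mem_enum.
pose F x := h @: f x.
have inj_F : injective F.
  move=> x y Exy; apply: inj_f; apply/finset.setP => u.
  have sub x' y' : F x' = F y' -> u \in f x' -> u \in f y'.
    move=> E ux; have : h u \in F y' by rewrite -E imset_f.
    case/imsetP => v vy /inj_h -> //; first exact: (fintype.subsetP (fQ x')).
    exact: (fintype.subsetP (fQ y')).
  by apply/idP/idP; apply: sub.
rewrite -cardsT -(card_imset _ inj_F) /town_max.
apply: (leq_bigmax_cond (F := fun G : {set {set 'I_n}} => #|G|)).
apply/is_townP => S SF cS.
pose J := [set x | F x \in S].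
have SE : S = F @: J.
  apply/finset.setP => A; apply/idP/imsetP => [AS|[x + ->]]; last by rewrite inE.
  have /imsetP[x _ Ax] := fintype.subsetP SF _ AS.
  by exists x; rewrite // inE -Ax.
have cJ : #|S| = #|J| by rewrite SE card_imset.
have [x0 x0J] : exists x, x \in J by apply/finset.set0Pn; rewrite -card_gt0 -cJ; case/andP: cS.
rewrite cJ -fcap -?cJ // SE big_imset /=; last by move=> x y _ _ /inj_F.
have -> : (\bigcap_(x in J) F x)%SET = h @: (\bigcap_(x in J) f x)%SET.
  apply/finset.setP => y; apply/finset.bigcapP/imsetP => [yF|[u /finset.bigcapP uf ->] x xJ].
    have /imsetP[u ux0 Ey] := yF _ x0J; exists u => //; apply/finset.bigcapP => x xJ.
    have /imsetP[v vx] := yF _ xJ; rewrite Ey => /inj_h -> //.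
      exact: (fintype.subsetP (fQ x0)).
    exact: (fintype.subsetP (fQ x)).
  by rewrite imset_f // uf.
rewrite card_in_imset // => u v /finset.bigcapP/(_ _ x0J) ux /finset.bigcapP/(_ _ x0J) vx.
by apply: inj_h; apply: (fintype.subsetP (fQ x0)).
Qed.

(** * Binomials modulo 2 and the lower-bound construction *)

(** By absorption [2 ^ e] divides [s] times the binomial; were the latter odd, [2 ^ e] would divide
    the smaller positive number [s]. *)
Lemma bin_pow2_even (e q s : nat) : (0 < s < 2 ^ e)%N -> ~~ odd 'C(2 ^ e * q, s).
Proof.
move=> /andP[s_gt0 lt_s]; apply/negP => odd_C.
have: (2 ^ e %| s * 'C(2 ^ e * q, s))%N.
  by case: s {lt_s odd_C} s_gt0 => // s _; rewrite -mul_bin_diag -mulnA dvdn_mulr.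
rewrite Gauss_dvdl; last by rewrite coprimeXl // coprime2n.
by move/(dvdn_leq s_gt0); rewrite leqNgt lt_s.
Qed.

(* Modulo 2, [2 ^ e * q] behaves as 0 in binomials with small lower index, so
   'C(m - j, s) becomes 'C(- j, s). *)
Lemma bin_subn_pow2_F2 (e q j s : nat) :
  (s < 2 ^ e)%N -> (j <= 2 ^ e * q)%N ->
  'C(2 ^ e * q - j, s)%:R = 'C(s + j - 1, s)%:R :> 'F_2.
Proof.
move=> + le_j; elim: j le_j s => [|j IHj] lt_j s.
  case: s => [|s] lt_s; first by rewrite !bin0.
  rewrite subn0 addn0 subn1 [in RHS]bin_small //; apply/eqP.
  by rewrite -(dvdn_pcharf (pchar_Fp (isT : prime 2))) dvdn2 bin_pow2_even.
elim: s => [|s IHs] lt_s; first by rewrite !bin0.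
have := IHj (ltnW lt_j) s.+1 lt_s.
have -> : (2 ^ e * q - j = (2 ^ e * q - j.+1).+1)%N by lia.
have -> : (s.+1 + j.+1 - 1 = (s.+1 + j - 1).+1)%N by lia.
rewrite !binS !natrD IHs ?(ltnW lt_s) // => <-.
have -> : (s + j.+1 - 1 = s.+1 + j - 1)%N by lia.
by rewrite -addrA addrr_F2 addr0.
Qed.

(** With m = 2^e q, symmetry gives C(m - j, s - j), which is C(s - 1, s - j) modulo 2. The lower
    index m - s keeps both sides zero for j > s, where the truncated s - j would give 1. *)
Lemma bin_link_pow2_F2 (e q j s : nat) :
  (0 < s < 2 ^ e)%N -> (0 < j)%N -> (j <= 2 ^ e * q)%N -> (s <= 2 ^ e * q)%N ->
  'C(2 ^ e * q - j, 2 ^ e * q - s)%:R = 'C(s.-1, j.-1)%:R :> 'F_2.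
Proof.
move=> /andP[s_gt0 lt_s] j_gt0 le_j le_s; case: (leqP j s) => [le_js|lt_sj]; last first.
  by rewrite !bin_small //; lia.
rewrite -bin_sub; last by lia.
have -> : (2 ^ e * q - j - (2 ^ e * q - s) = s - j)%N by lia.
rewrite bin_subn_pow2_F2 //; last by lia.
rewrite -[in RHS]bin_sub; last by lia.
by congr ('C(_, _)%:R); lia.
Qed.

(* [gamma^(2s)] is realised on the s-subsets containing a given point, and
   [gamma^(2s+1)] on those avoiding it. *)
Definition star (m i : nat) (x : 'I_m) (P : {set 'I_m}) : bool :=
  if odd i then x \notin P else x \in P.

Lemma card_star_gamma (e q i : nat) (J : {set 'I_(2 ^ e * q)}) :
  (0 < i < 2 ^ e)%N -> (0 < #|J|)%N -> (0 < q)%N ->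
  #|[set P in ksubsets [set: 'I_(2 ^ e * q)] i./2 | [forall x in J, star i x P]]|%:R
  = gamma i #|J|.
Proof.
move=> /andP[i_gt0 lt_i] J_gt0 q_gt0.
have le_J : (#|J| <= 2 ^ e * q)%N by rewrite -[X in (_ <= X)%N]card_ord max_card.
have le_e : (2 ^ e <= 2 ^ e * q)%N by rewrite leq_pmulr.
have cC (S : {set 'I_(2 ^ e * q)}) : #|~: S| = (2 ^ e * q - #|S|)%N.
  by rewrite cardsCs finset.setCK card_ord.
rewrite /gamma; case: (boolP (odd i)) => odd_i.
  transitivity ('C(2 ^ e * q - #|J|, i./2)%:R : 'F_2).
    rewrite -cC -card_ksubsets; congr (_%:R); apply: eq_card => P.
    rewrite !inE finset.subsetT /= andbC; congr (_ && _).
    apply/forall_inP/fintype.subsetP => H x.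
      by move=> xP; rewrite inE; apply/negP => /H; rewrite /star odd_i xP.
    by move=> xJ; rewrite /star odd_i; apply/negP => /H; rewrite inE xJ.
  rewrite bin_subn_pow2_F2 //; last by lia.
  rewrite -[in RHS]bin_sub; last by lia.
  by congr ('C(_, _)%:R); lia.
(* Complementation turns the subsets containing [J] into the subsets of [~: J] of complementary
   size. *)
transitivity ('C(2 ^ e * q - #|J|, 2 ^ e * q - i./2)%:R : 'F_2).
  rewrite -cC -card_ksubsets -(card_imset _ (@finset.setC_inj _)).
  congr (_%:R); apply: eq_card => P.
  rewrite -[P in LHS]finset.setCK mem_imset ?inE; last exact: finset.setC_inj.
  rewrite finset.subsetT /= andbC; congr (_ && _).
    apply/forall_inP/fintype.subsetP => H x.
      by move=> xP; rewrite inE; apply/negP => /H; rewrite /star (negbTE odd_i) inE xP.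
    move=> xJ; rewrite /star (negbTE odd_i) inE; apply/negP => /H.
    by rewrite inE xJ.
  have le_P : (#|P| <= 2 ^ e * q)%N by rewrite -[X in (_ <= X)%N]card_ord max_card.
  have aux p N h : (p <= N)%N -> (h <= N)%N -> ((N - p)%N == h) = (p == (N - h)%N) by lia.
  by rewrite (cC P) aux //; lia.
rewrite bin_link_pow2_F2 //; lia.
Qed.

Lemma ffact_leq_exp (m s : nat) : (m ^_ s <= m ^ s)%N.
Proof.
elim: s => [|s IH] //; rewrite ffactnSr expnSr.
by apply: leq_mul => //; apply: leq_subr.
Qed.

Lemma bin_leq_exp (m s : nat) : ('C(m, s) <= m ^ s)%N.
Proof.
by apply: leq_trans (ffact_leq_exp m s); rewrite -bin_ffact leq_pmulr ?fact_gt0.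
Qed.

Lemma card_pairs (I J : finType) (B : {set I * J}) :
  #|B| = (\sum_(i : I) #|[set j | (i, j) \in B]|)%N.
Proof.
rewrite -sum1_card big_mkcond.
transitivity (\sum_i \sum_j if (i, j) \in B then 1 else 0)%N.
  by rewrite pair_bigA; apply: eq_bigr => -[].
apply: eq_bigr => i _; rewrite -big_mkcond -sum1_card.
by apply: eq_bigl => j; rewrite inE.
Qed.

(** Such a subset is a point on which the members indexed by [x] and [y] differ, for either kind of
    [star]. *)
Lemma separating_ksubset (m t : nat) (x y : 'I_m) :
  (0 < t < m)%N -> x != y ->
  exists P, [/\ P \in ksubsets [set: 'I_m] t, x \in P & y \notin P].
Proof.
move=> /andP[t_gt0 lt_tm] xy.
have : (0 < #|ksubsets (~: [set x; y]) t.-1|)%N.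
  rewrite card_ksubsets bin_gt0 cardsCs finset.setCK card_ord cards2 xy; lia.
rewrite card_gt0 => /finset.set0Pn[S /ksubsetsP[Sxy cS]].
have notS u : u \in [set x; y] -> u \notin S.
  by move=> uxy; apply/negP => /(fintype.subsetP Sxy); rewrite inE uxy.
exists (x |: S); split; last 2 first.
- by rewrite finset.setU11.
- by rewrite finset.in_setU1 negb_or eq_sym xy notS // finset.set22.
by apply/ksubsetsP; rewrite finset.subsetT cardsU1 notS ?finset.set21 // cS add1n prednK.
Qed.

(** Points are pairs (index, subset), so that the two sequences of one level use disjoint copies of
    the same subsets and intersection sizes add up to [canon_seq]. The top level costs [grade alpha]
    copies of ['C(m, t)]; each lower index costs at most [m ^ t.-1]. *)
Lemma leq_town_max_pow2 (k : nat) (alpha : 'rV['F_2]_k) (n e q : nat) :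
  let t := level alpha in let m := (2 ^ e * q)%N in
  (0 < t)%N -> (0 < grade alpha)%N -> (k < 2 ^ e)%N -> (0 < q)%N -> (0 < n)%N ->
  (grade alpha * 'C(m, t) + k * m ^ t.-1 <= n)%N ->
  (m <= town_max alpha n)%N.
Proof.
move=> t m t_gt0 g_gt0 lt_ke q_gt0 n_gt0 le_n.
have le_em : (2 ^ e <= m)%N by rewrite leq_pmulr.
have m_gt0 : (0 < m)%N by rewrite (leq_trans _ le_em) ?expn_gt0.
pose Q : {set 'I_k * {set 'I_m}} :=
  [set u : 'I_k * {set 'I_m} | appears alpha u.1.+1 && (u.2 \in ksubsets [set: 'I_m] u.1.+1./2)].
pose f (x : 'I_m) := [set u : 'I_k * {set 'I_m} in Q | star u.1.+1 x u.2].
(* An index of top level, whose [t]-subsets make the members distinct. *)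
have [i [ai it]] : exists i : 'I_k, appears alpha i.+1 /\ i.+1./2 = t.
  have [p ap pt] : exists2 p, appears alpha p & p./2 = t.
    move: g_gt0; rewrite /grade -/t.
    case: (boolP (appears alpha t.*2)) => [ap _|_]; first by exists t.*2; rewrite ?doubleK.
    by case: (boolP (appears alpha t.*2.+1)) => // ap _; exists t.*2.+1; rewrite //= uphalf_double.
  have /andP[p_gt0 le_pk] := appears_le ap.
  have lt_pk : (p.-1 < k)%N by rewrite prednK.
  by exists (Ordinal lt_pk); have -> : (Ordinal lt_pk).+1 = p by rewrite /= prednK.
have inj_f : injective f.
  move=> x y Exy; apply/eqP/negPn/negP => xy.
  have [|P [Pt xP yP]] := @separating_ksubset m t x y _ xy.
    by rewrite t_gt0 -it (leq_trans _ le_em) // (leq_trans _ lt_ke) //; have := ltn_ord i; lia.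
  have PQ : (i, P) \in Q by rewrite inE ai it.
  have := Exy; move/finset.setP/(_ (i, P)); rewrite [_ \in f x]inE [_ \in f y]inE PQ.
  by rewrite /star; case: ifP; rewrite xP (negbTE yP).
rewrite -[m]card_ord; apply: (@leq_town_max _ _ _ _ _ Q f) => //.
- by move=> x; apply/fintype.subsetP => u; rewrite !inE => /andP[].
- rewrite card_pairs; apply: leq_trans le_n.
  have -> : (k * m ^ t.-1 = \sum_(j < k) m ^ t.-1)%N.
    by rewrite sum_nat_const card_ord.
  rewrite /grade -/t -(sum_appears alpha t.*2) -(sum_appears alpha t.*2.+1).
  rewrite -big_split big_distrl -big_split /=; apply: leq_sum => j _.
  have -> : #|[set P | (j, P) \in Q]| = (appears alpha j.+1 * 'C(m, j.+1./2))%N.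
    case: (boolP (appears alpha j.+1)) => aj.
      rewrite mul1n -[m in RHS]card_ord -cardsT -card_ksubsets.
      by apply: eq_card => P; rewrite inE inE /= aj.
    by rewrite mul0n; apply: eq_card0 => P; rewrite inE inE /= (negbTE aj).
  case: (boolP (appears alpha j.+1)) => aj; last by rewrite mul0n.
  rewrite mul1n !andTb.
  have := appears_level aj; rewrite -/t => le_jt.
  case: (eqVneq j.+1 t.*2) => [->|ne_j].
    by rewrite doubleK mulnDl mul1n -addnA leq_addr.
  case: (eqVneq j.+1 t.*2.+1) => [->|ne_j'].
    by rewrite [_.+1./2]/= uphalf_double add0n mul1n leq_addr.
  rewrite addn0 mul0n add0n; apply: leq_trans (bin_leq_exp _ _) _.
  by rewrite leq_pexp2l //; lia.
move=> J /andP[J_gt0 le_Jk]; rewrite card_pairs natr_sum; apply: eq_bigr => j _.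
rewrite -(card_star_gamma _ J_gt0 q_gt0); last by rewrite /= (leq_ltn_trans _ lt_ke).
rewrite -natrM; congr (_%:R).
have capE P : ((j, P) \in (\bigcap_(x in J) f x)%SET)
    = appears alpha j.+1 && ((P \in ksubsets [set: 'I_m] j.+1./2)
        && [forall x in J, star j.+1 x P]).
  have [x0 x0J] : exists x, x \in J by apply/finset.set0Pn; rewrite -card_gt0.
  rewrite andbA; apply/finset.bigcapP/andP => [H|[jQ /forall_inP H] x xJ].
    split; first by have := H _ x0J; rewrite !inE => /andP[].
    by apply/forall_inP => x /H; rewrite inE => /andP[].
  by rewrite inE H // andbT inE.
case: (boolP (appears alpha j.+1)) capE => aj capE.
  by rewrite mul1n; apply: eq_card => P; rewrite !inE capE inE.
by rewrite mul0n; apply: eq_card0 => P; rewrite inE capE.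
Qed.

(** * Bounds up to additive constants, and the asymptotics *)

Lemma subn_exp_leq_ffact (h t : nat) : ((h - t) ^ t <= h ^_ t)%N.
Proof.
elim: t => [|t IH] //; rewrite ffactnSr expnSr leq_mul //; last by lia.
by apply: leq_trans IH; case: t => [//|t]; rewrite leq_exp2r //; lia.
Qed.

Lemma town_max_attained (k : nat) (alpha : 'rV['F_2]_k) (n : nat) :
  exists2 F : {set {set 'I_n}}, is_town alpha F & town_max alpha n = #|F|.
Proof.
have t0 : is_town alpha (finset.set0 : {set {set 'I_n}}).
  by apply/is_townP => S; rewrite finset.subset0 => /eqP ->; rewrite cards0.
have [|F ? ?] := @eq_bigmax_cond _ (is_town alpha (n := n)) (fun F : {set {set 'I_n}} => #|F|).
  by apply/card_gt0P; exists finset.set0.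
by exists F.
Qed.

(** If the inequality failed, the construction with the least multiple of [2 ^ k] above
    [town_max alpha n] would fit in [n] points. The constant [D] pays for the lower levels through
    (m + D)^t >= m^t + D m^(t-1). *)
Lemma town_max_lower (k : nat) (alpha : 'rV['F_2]_k) :
  let t := level alpha in let g := grade alpha in (0 < t)%N -> (0 < g)%N ->
  exists C, forall n, (0 < n)%N -> (t`! * n < g * (town_max alpha n + C) ^ t)%N.
Proof.
move=> t g t_gt0 g_gt0; pose D := (k * t`!)%N.
exists (2 ^ k + D)%N => n n_gt0; rewrite ltnNge; apply/negP => le_n.
set f := town_max alpha n in le_n *.
pose q := (f %/ 2 ^ k).+1; pose m := (2 ^ k * q)%N.
have pow_gt0 : (0 < 2 ^ k)%N by rewrite expn_gt0.
have lt_fm : (f < m)%N by rewrite /m mulnC ltn_ceil.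
have le_mf : (m <= f + 2 ^ k)%N.
  by rewrite /m /q mulnS addnC mulnC leq_add2r leq_trunc_div.
suff : (m <= f)%N by rewrite leqNgt lt_fm.
apply: leq_town_max_pow2 => //; first exact: ltn_expl.
rewrite -/t -/g -/m -(leq_pmul2l (fact_gt0 t)).
apply: leq_trans _ le_n; apply: (@leq_trans (g * (m + D) ^ t)); last first.
  by rewrite leq_mul2l leq_exp2r // addnA leq_add2r le_mf orbT.
apply: (@leq_trans (g * (m ^ t + D * m ^ t.-1))); last first.
  rewrite leq_mul2l; apply/orP; right.
  rewrite -{1 3}(prednK t_gt0) !expnS -mulnDl leq_mul // //.
  by case: t.-1 => // t'; rewrite leq_exp2r // leq_addr.
rewrite !mulnDr leq_add //.
  by rewrite mulnCA leq_mul2l mulnC bin_ffact ffact_leq_exp orbT.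
rewrite mulnA [(t`! * k)%N]mulnC -/D.
by rewrite -[X in (X <= _)%N]mul1n leq_mul.
Qed.

Lemma town_max_upper (k : nat) (alpha : 'rV['F_2]_k) :
  let t := level alpha in let g := grade alpha in (0 < t)%N -> (0 < g)%N ->
  exists C, forall n, (g * (town_max alpha n - C) ^ t <= t`! * n)%N.
Proof.
move=> t g t_gt0 g_gt0; pose D := (t`! * t * 2 ^ t.-1)%N.
(* The 1 is for the removed member, one [t] for comparing the falling factorial with a power, the
   other [t] to ensure [t < X], and [D] for the binomials of lower order. *)
exists (1 + t + t + D)%N => n.
have [F Ft ->] := town_max_attained alpha n.
set X := (#|F|.-1 - t)%N.
have -> : (#|F| - (1 + t + t + D) = X - t - D)%N by rewrite /X; lia.
case: (leqP (X - t) D) => [|lt_D]; first by rewrite -subn_eq0 => /eqP ->; rewrite exp0n // muln0.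
have F_gt0 : (0 < #|F|)%N by rewrite /X in lt_D; lia.
have := town_card_bound Ft t_gt0 F_gt0 g_gt0; rewrite -/t -/g => bnd.
have le_sum : (\sum_(r < t) 'C(#|F|.-1, r) <= t * #|F|.-1 ^ t.-1)%N.
  rewrite -[X in (_ <= X * _)%N]card_ord -sum_nat_const; apply: leq_sum => r _.
  apply: leq_trans (bin_leq_exp _ _) _; rewrite leq_pexp2l //.
    by rewrite /X in lt_D; lia.
  by have := ltn_ord r; lia.
(* Here [#|F|.-1] equals [X + t], hence is at most [2 * X]. *)
have le_h : (#|F|.-1 ^ t.-1 <= 2 ^ t.-1 * X ^ t.-1)%N.
  rewrite -expnMn; case: t.-1 => // t'; rewrite leq_exp2r //.
  by rewrite /X in lt_D *; lia.
have le_fact : (X ^ t <= t`! * 'C(#|F|.-1, t))%N.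
  by rewrite mulnC bin_ffact subn_exp_leq_ffact.
rewrite -(leq_add2r (g * (D * X ^ t.-1))) -mulnDr.
apply: (@leq_trans (g * X ^ t)).
  rewrite leq_mul2l; apply/orP; right.
  rewrite -{2 4}(prednK t_gt0) !expnS.
  apply: (@leq_trans ((X - t - D) * X ^ t.-1 + D * X ^ t.-1)).
    rewrite leq_add2r leq_mul //; case: t.-1 => // t'; rewrite leq_exp2r //; lia.
  by rewrite -mulnDl leq_mul //; lia.
apply: (@leq_trans (t`! * (g * 'C(#|F|.-1, t)))).
  by rewrite mulnCA leq_mul2l le_fact orbT.
apply: (@leq_trans (t`! * (n + g * (t * #|F|.-1 ^ t.-1)))).
  rewrite leq_mul2l; apply/orP; right; apply: leq_trans bnd _.
  by rewrite leq_add2l leq_mul2l le_sum orbT.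
rewrite mulnDr leq_add2l mulnCA leq_mul2l; apply/orP; right.
by rewrite /D -mulnA -mulnA !leq_mul2l le_h !orbT.
Qed.

(** Taking [t]-th roots keeps [f n] within [C1 + C2] of the main term [y n], which tends to
    infinity. *)
Lemma eq_1o1_root (R : realType) (f : nat -> nat) (t g C1 C2 : nat) :
  (0 < t)%N -> (0 < g)%N ->
  (forall n, (g * (f n - C1) ^ t <= t`! * n)%N) ->
  (forall n, (0 < n)%N -> (t`! * n < g * (f n + C2) ^ t)%N) ->
  eq_1o1 (fun n => (f n)%:R : R)
         (fun n => (t`!%:R / g%:R) `^ (1 / t%:R) * n%:R `^ (1 / t%:R)).
Proof.
move=> t_gt0 g_gt0 up low.
set y := fun n : nat => _ * _.
have t_neq0 : t%:R != 0 :> R by rewrite pnatr_eq0 -lt0n.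
have g_pos : 0 < g%:R :> R by rewrite ltr0n.
have F_pos : 0 < t`!%:R :> R by rewrite ltr0n fact_gt0.
have y_ge0 n : 0 <= y n by rewrite mulr_ge0 ?powR_ge0.
have yX n : y n ^+ t = t`!%:R / g%:R * n%:R.
  rewrite exprMn -!powR_mulrn ?powR_ge0 // -!powRrM mul1r mulVf //.
  by rewrite !powRr1 // ?ler0n // divr_ge0 ?ler0n.
have y_gt0 n : (0 < n)%N -> 0 < y n.
  by move=> n_gt0; rewrite mulr_gt0 ?powR_gt0 ?divr_gt0 ?ltr0n ?fact_gt0.
have f_up n : (f n)%:R - C1%:R <= y n.
  apply: (@le_trans _ _ (f n - C1)%:R).
    by rewrite lerBlDr -natrD ler_nat; lia.
  rewrite -(@ler_pXn2r _ t) ?nnegrE ?ler0n // yX mulrAC ler_pdivlMr //.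
  by rewrite -natrX -!natrM ler_nat mulnC up.
have f_low n : (0 < n)%N -> y n <= (f n)%:R + C2%:R.
  move=> n_gt0; rewrite -natrD -(@ler_pXn2r _ t) ?nnegrE ?ler0n // yX mulrAC ler_pdivrMr //.
  by rewrite -natrX -!natrM ler_nat [leqRHS]mulnC ltnW // low.
exists (fun n => (f n)%:R / y n - 1); last first.
  near=> n; have n_gt0 : (0 < n)%N by near: n; exact: nbhs_infty_gt.
  by rewrite addrC subrK divfK // gt_eqF // y_gt0.
apply/cvgrPdist_le => eps eps_gt0; near=> n.
have n_gt0 : (0 < n)%N by near: n; exact: nbhs_infty_gt.
have yn := y_gt0 n n_gt0.
pose C : R := C1%:R + C2%:R.
have C_ge0 : 0 <= C by rewrite addr_ge0 ?ler0n.
(* After raising to the power [t], this is a linear lower bound on [n]. *)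
have le_C : C <= eps * y n.
  rewrite mulrC -ler_pdivrMr // -(@ler_pXn2r _ t) ?nnegrE ?divr_ge0 // ?(ltW eps_gt0) //.
  rewrite yX [leRHS]mulrC -ler_pdivrMr ?divr_gt0 //.
  by near: n; apply: nbhs_infty_ger.
have -> : 0 - ((f n)%:R / y n - 1) = (y n - (f n)%:R) / y n.
  by rewrite sub0r opprB mulrBl divff // gt_eqF.
rewrite normrM [`|_^-1|]gtr0_norm ?invr_gt0 // ler_pdivrMr //.
apply: le_trans le_C; rewrite ler_norml /C.
have := f_up n; have := f_low n n_gt0; have := ler0n R C1; have := ler0n R C2.
by move=> *; apply/andP; split; lra.
Unshelve. all: by end_near.
Qed.

(** * The constant vectors, by linear algebra over ['F_2] *)

Lemma canon_seq_const (k : nat) (c : 'F_2) (j : nat) :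
  (0 < j <= k)%N -> canon_seq (const_mx c : 'rV['F_2]_k) j = c.
Proof.
move=> /andP[j_gt0 le_jk]; have lt_jk : (j.-1 < k)%N by rewrite prednK.
have := canon_seqE (const_mx c : 'rV['F_2]_k) (Ordinal lt_jk).
by rewrite /= prednK // mxE.
Qed.

(** Rows are determined by their coordinates in a basis of the row space. *)
Lemma leq_pow_rank (p n : nat) (M : 'M['F_2]_(p, n)) :
  injective (fun i => row i M) -> (p <= 2 ^ \rank M)%N.
Proof.
move=> injM; pose B := row_base M; pose D := M *m pinvmx B.
have MD : M = D *m B by rewrite mulmxKpV // eq_row_base.
have injD : injective (fun i => row i D).
  by move=> i j /= E; apply: injM; rewrite /= MD (row_mul i D) (row_mul j D) E.
have := leq_card _ injD; rewrite card_ord card_mx mul1n.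
by rewrite card_Fp.
Qed.

Section TownMatrix.

Variables (n : nat) (F : {set {set 'I_n}}).

Definition town_mx : 'M['F_2]_(#|F|, n) := \matrix_(i < #|F|, p < n) (p \in (enum_val i : {set 'I_n}))%:R.

Lemma town_mx_mul (i j : 'I_#|F|) :
  (town_mx *m town_mx^T) i j = #|enum_val i :&: enum_val j|%:R.
Proof.
rewrite mxE -[in RHS]sum1_card natr_sum [RHS]big_mkcond /=; apply: eq_bigr => p _.
by rewrite !mxE -natrM inE; case: (p \in _); case: (p \in _).
Qed.

Lemma town_mx_inj : injective (fun i => row i town_mx).
Proof.
move=> i j /rowP E; apply/enum_val_inj/finset.setP => p.
by have := E p; rewrite !mxE; do 2!case: (p \in _).
Qed.

Lemma const_town_mul (k : nat) (c : 'F_2) (i j : 'I_#|F|) : (1 < k)%N ->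
  is_town (const_mx c : 'rV['F_2]_k) F -> (town_mx *m town_mx^T) i j = c.
Proof.
move=> k_gt1 /is_townP Ft; rewrite town_mx_mul.
set A := enum_val i; set B := enum_val j.
(* For [A = B] the pair collapses to a singleton, so the diagonal is covered too. *)
have -> : A :&: B = (\bigcap_(C in [set A; B]) C)%SET.
  case: (eqVneq A B) => [->|AB]; first by rewrite finset.setIid finset.setUid finset.big_set1.
  by rewrite finset.big_setU1 ?inE // finset.big_set1.
have c2 : (0 < #|[set A; B]| <= k)%N.
  by rewrite cards2 /= (leq_trans _ k_gt1) //; case: (_ != _).
rewrite Ft ?canon_seq_const //.
by apply/fintype.subsetP => C; rewrite !inE => /orP[] /eqP ->; apply: enum_valP.
Qed.

End TownMatrix.

(** The row space is self-orthogonal, so its dimension is at most n/2. *)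
Lemma even_town_upper (k n : nat) (F : {set {set 'I_n}}) : (1 < k)%N ->
  is_town (const_mx 0 : 'rV['F_2]_k) F -> (#|F| <= 2 ^ (n %/ 2))%N.
Proof.
move=> k_gt1 Ft; apply: leq_trans (leq_pow_rank (@town_mx_inj _ F)) _.
rewrite leq_exp2l // leq_divRL // muln2 -addnn.
have := @mulmx0_rank_max _ _ _ _ (town_mx F) (town_mx F)^T.
rewrite mxrank_tr; apply; apply/matrixP => i j.
by rewrite (const_town_mul _ _ k_gt1 Ft) mxE.
Qed.

(** Subtracting one row [v] from all rows gives a matrix [N] whose rows are orthogonal to each other
    and to [v]. As [v] has product 1 with itself, it lies outside the row space of [N], whence 2
    rank N + 1 <= n. *)
Lemma odd_town_upper (k n : nat) (F : {set {set 'I_n}}) : (1 < k)%N ->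
  is_town (const_mx 1 : 'rV['F_2]_k) F -> (#|F| <= 2 ^ ((n - 1) %/ 2))%N.
Proof.
move=> k_gt1 Ft; case: (posnP #|F|) => [->//|F_gt0].
pose M := town_mx F; pose v := row (Ordinal F_gt0) M.
have MM : M *m M^T = const_mx 1.
  by apply/matrixP => i j; rewrite (const_town_mul _ _ k_gt1 Ft) mxE.
have vM : v *m M^T = const_mx 1.
  by rewrite -row_mul MM; apply/matrixP => i j; rewrite !mxE.
have Mv : M *m v^T = const_mx 1 by rewrite -[LHS]trmxK trmx_mul trmxK vM trmx_const.
have vv : v *m v^T = const_mx 1.
  by rewrite -row_mul Mv; apply/matrixP => i j; rewrite !mxE.
have JJ p q : (const_mx 1 : 'M['F_2]_(p, 1)) *m (const_mx 1 : 'M['F_2]_(1, q)) = const_mx 1.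
  by apply/matrixP => i j; rewrite !mxE big_ord1 !mxE mulr1.
pose N := M - const_mx 1 *m v.
have Nv : N *m v^T = 0 by rewrite mulmxBl Mv -mulmxA vv JJ subrr.
have NM : N *m M^T = 0 by rewrite mulmxBl MM -mulmxA vM JJ subrr.
have NN : N *m N^T = 0.
  by rewrite {2}/N linearB /= mulmxBr NM trmx_mul mulmxA Nv mul0mx subrr.
have injN : injective (fun i => row i N).
  move=> i j /= E; apply: (@town_mx_inj _ F) => /=; move: E.
  by rewrite !linearB /= !row_mul !row_const => /addIr.
apply: leq_trans (leq_pow_rank injN) _.
have lt_rank : (\rank N < \rank (col_mx N v))%N.
  rewrite -addsmxE ltn_neqAle.
  have le_Nv : (N <= N + v)%MS by apply: addsmxSl.
  have [-> ->] := mxrank_leqif_sup le_Nv; rewrite andbT addsmx_sub submx_refl /=.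
  apply/negP => /submxP[D vD]; have := vv; rewrite {1}vD -mulmxA Nv mulmx0.
  by move/matrixP/(_ 0 0); rewrite !mxE.
have := @mulmx0_rank_max _ _ _ _ N (col_mx N v)^T.
rewrite mxrank_tr tr_col_mx mul_mx_row NN Nv row_mx0 => /(_ erefl) le_n.
by rewrite leq_exp2l // leq_divRL //; lia.
Qed.

(** Points are grouped in pairs and members are unions of pairs, a family closed under
    intersection. *)
Lemma even_town_lower (k n : nat) : (0 < n)%N ->
  (2 ^ (n %/ 2) <= town_max (const_mx 0%R : 'rV['F_2]_k) n)%N.
Proof.
move=> n_gt0; pose h := (n %/ 2)%N.
rewrite -[(n %/ 2)%N](card_ord h) -cardsT -card_powerset finset.powersetT cardsT.
pose f (x : {set 'I_h}) : {set 'I_h * bool} := finset.setX x [set: bool].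
apply: (@leq_town_max _ _ _ _ _ [set: 'I_h * bool] f) => //.
- move=> x y /finset.setP E; apply/finset.setP => i.
  by have := E (i, true); rewrite !finset.in_setX !inE !andbT.
- by rewrite cardsT card_prod card_ord card_bool leq_trunc_div.
move=> J cJ; rewrite canon_seq_const //.
have -> : (\bigcap_(x in J) f x)%SET = finset.setX (\bigcap_(x in J) x)%SET [set: bool].
  apply/finset.setP => -[i b]; rewrite finset.in_setX inE andbT.
  apply/finset.bigcapP/finset.bigcapP => H x /H; rewrite finset.in_setX inE andbT //.
rewrite cardsX cardsT card_bool muln2 -addnn natrD addrr_F2 //.
Qed.

(** The same unions of pairs, all enlarged by the common point [None]. *)
Lemma odd_town_lower (k n : nat) : (0 < n)%N ->
  (2 ^ ((n - 1) %/ 2) <= town_max (const_mx 1%R : 'rV['F_2]_k) n)%N.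
Proof.
move=> n_gt0; pose h := ((n - 1) %/ 2)%N.
rewrite -[((n - 1) %/ 2)%N](card_ord h) -cardsT -card_powerset finset.powersetT cardsT.
pose f (x : {set 'I_h}) : {set option ('I_h * bool)} :=
  None |: Some @: finset.setX x [set: bool].
have fE x i b : (Some (i, b) \in f x) = (i \in x).
  rewrite finset.in_setU1 /= mem_imset; last by move=> ? ? [].
  by rewrite finset.in_setX finset.in_setT andbT.
apply: (@leq_town_max _ _ _ _ _ [set: option ('I_h * bool)] f) => //.
- move=> x y /finset.setP E; apply/finset.setP => i.
  by have := E (Some (i, true)); rewrite !fE.
- by rewrite cardsT card_option card_prod card_ord card_bool /h; lia.
move=> J cJ; rewrite canon_seq_const //.
have -> : (\bigcap_(x in J) f x)%SET = f (\bigcap_(x in J) x)%SET.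
  apply/finset.setP => -[[i b]|]; last by rewrite finset.setU11; apply/finset.bigcapP => x _; exact: finset.setU11.
  rewrite fE; apply/finset.bigcapP/finset.bigcapP => H x /H; rewrite fE //.
rewrite /f cardsU1 card_imset; last by move=> ? ? [].
rewrite cardsX cardsT card_bool muln2 -addnn natrD natrD addrr_F2 addr0.
by rewrite (_ : None \notin _) //; apply/negP => /imsetP[].
Qed.

Theorem theorem3 (R : realType) (k : nat) (hk : (1 < k)%N) (alpha : 'rV['F_2]_k) :
  [/\ level alpha = 0%N -> alpha = const_mx 0 ->
        forall n : nat, (0 < n)%N -> town_max alpha n = (2 ^ (n %/ 2))%N,
      level alpha = 0%N -> alpha = const_mx 1 ->
        forall n : nat, (0 < n)%N -> town_max alpha n = (2 ^ ((n - 1) %/ 2))%N,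
      forall t : nat, level alpha = t -> (0 < t)%N -> grade alpha = 1%N ->
        eq_1o1 (fun n => (town_max alpha n)%:R : R)
               (fun n => (t`!%:R) `^ (1 / t%:R) * n%:R `^ (1 / t%:R))
    & forall t : nat, level alpha = t -> (0 < t)%N -> grade alpha = 2%N ->
        eq_1o1 (fun n => (town_max alpha n)%:R : R)
               (fun n => (t`!%:R / 2) `^ (1 / t%:R) * n%:R `^ (1 / t%:R))].
Proof.
split=> [_ -> n n_gt0|_ -> n n_gt0|t <- t_gt0 g1|t <- t_gt0 g2].
- have [F Ft E] := town_max_attained (const_mx 0 : 'rV['F_2]_k) n.
  by apply/eqP; rewrite eqn_leq {1}E (even_town_upper hk Ft) even_town_lower.
- have [F Ft E] := town_max_attained (const_mx 1 : 'rV['F_2]_k) n.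
  by apply/eqP; rewrite eqn_leq {1}E (odd_town_upper hk Ft) odd_town_lower.
- have g_gt0 : (0 < grade alpha)%N by rewrite g1.
  have [C1 up] := town_max_upper t_gt0 g_gt0.
  have [C2 low] := town_max_lower t_gt0 g_gt0.
  by have := eq_1o1_root R t_gt0 g_gt0 up low; rewrite g1 divr1.
have g_gt0 : (0 < grade alpha)%N by rewrite g2.
have [C1 up] := town_max_upper t_gt0 g_gt0.
have [C2 low] := town_max_lower t_gt0 g_gt0.
by have := eq_1o1_root R t_gt0 g_gt0 up low; rewrite g2.
Qed.
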